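(* Let $U$ and $V$ be connected digital images in some $\mathbb{Z}^n$ with connected intersection $U\cap V$. Choose $x_0\in U\cap V$ as the basepoint of $U\cap V$, $U$, $V$ and $U\cup V$. Suppose $U$ and $V$ have disconnected complements. Let $i_1\colon\pi_1(U\cap V;x_0)\to\pi_1(U;x_0)$, $i_2\colon\pi_1(U\cap V;x_0)\to\pi_1(V;x_0)$, $\psi_1\colon\pi_1(U;x_0)\to\pi_1(U\cup V;x_0)$ and $\psi_2\colon\pi_1(V;x_0)\to\pi_1(U\cup V;x_0)$ be the homomorphisms of digital fundamental groups induced by the inclusions. Then the square formed by $i_1,i_2,\psi_1,\psi_2$ is a pushout diagram of groups and homomorphisms. That is, $\psi_1\circ i_1=\psi_2\circ i_2$, and for any group $G$ and any homomorphisms $h_1\colon\pi_1(U;x_0)\to G$ and $h_2\colon\pi_1(V;x_0)\to G$ with $h_1\circ i_1=h_2\circ i_2$, there is a unique homomorphism $\phi\colon\pi_1(U\cup V;x_0)\to G$ with $\phi\circ\psi_1=h_1$ and $\phi\circ\psi_2=h_2$.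
   Context: A digital image is a finite subset $X\subseteq\mathbb{Z}^n$ (for some $n$) with the adjacency relation $x\sim_X y$ iff $|x_i-y_i|\le 1$ for all $i=1,\ldots,n$ (reflexive and symmetric). A based digital image also has a chosen basepoint $x_0\in X$. A function $f\colon X\to Y$ of digital images is continuous if $x\sim_X x'$ implies $f(x)\sim_Y f(x')$. For $N\ge 0$, $I_N=\{0,1,\ldots,N\}\subseteq\mathbb{Z}$. A based digital image $X$ is connected if for every $x\in X$ there is a continuous $\alpha\colon I_N\to X$ (some $N\ge0$) with $\alpha(0)=x_0$, $\alpha(N)=x$. Products carry the adjacency $(x,y)\sim(x',y')$ iff $x\sim x'$ and $y\sim y'$. A based loop of length $N$ in $X$ is a continuous $\alpha\colon I_N\to X$ with $\alpha(0)=\alpha(N)=x_0$. Based loops $\alpha,\beta\colon I_M\to X$ of the same length are based homotopic as based loops, $\alpha\approx\beta$, if for some $R\ge1$ there is a continuous $H\colon I_M\times I_R\to X$ with $H(s,0)=\alpha(s)$, $H(s,R)=\beta(s)$ and $H(0,t)=H(M,t)=x_0$ for all $s,t$. For $k\ge1$ let $\rho_k\colon I_{kN+k-1}\to I_N$, $\rho_k(i)=\lfloor i/k\rfloor$. Based loops $\alpha\colon I_M\to X$, $\beta\colon I_N\to X$ are subdivision-based homotopic if for some $k,l\ge1$ with $k(M+1)=l(N+1)$ we have $\alpha\circ\rho_k\approx\beta\circ\rho_l$ as based loops. This is an equivalence relation on the based loops of all lengths; the digital fundamental group $\pi_1(X;x_0)$ is the set of classes $[\alpha]$. It is a group under $[\alpha]\cdot[\beta]=[\alpha\cdot\beta]$,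 where for $\alpha\colon I_M\to X$, $\beta\colon I_N\to X$ the loop $\alpha\cdot\beta\colon I_{M+N+1}\to X$ equals $\alpha(t)$ for $0\le t\le M$ and $\beta(t-(M+1))$ for $M+1\le t\le M+N+1$; the identity is the class of constant loops, and inverses are given by reversing loops. A based continuous map $f$ induces the homomorphism $[\alpha]\mapsto[f\circ\alpha]$. For digital images $U,V\subseteq\mathbb{Z}^n$, let $U'=V\setminus(U\cap V)$ and $V'=U\setminus(U\cap V)$ be the complements of $U$ and of $V$ in $U\cup V$. $U$ and $V$ have disconnected complements if there is no pair $u\in V'$, $v\in U'$ with $u\sim_{U\cup V}v$. *)

(* Defs.v *)
From HB Require Import structures.
From mathcomp Require Import all_boot all_order all_algebra finmap boolp zify.

Set Implicit Arguments.
Unset Strict Implicit.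
Unset Printing Implicit Defensive.

Import Order.TTheory GRing.Theory Num.Theory.

Local Open Scope fset_scope.
Local Open Scope nat_scope.
Local Open Scope quotient_scope.

(* A digital image is a term of type [{fset 'rV[int]_n}]: a finite subset of Z^n. *)

Definition adj n (x y : 'rV[int]_n) : bool :=
  [forall i, (`|x 0 i - y 0 i| <= 1)%R].

Definition adj_in n (X : {fset 'rV[int]_n}) (x y : X) : bool :=
  adj (val x) (val y).

(* The interval I_N is 'I_N.+1; this is its adjacency as a subset of Z. *)
Definition adj_ord N (i j : 'I_N.+1) : bool := (`|i%:Z - j%:Z| <= 1)%R.

Definition adj_prod (S T : Type) (rS : rel S) (rT : rel T) (p q : S * T) : bool :=
  rS p.1 q.1 && rT p.2 q.2.

Definition dcontinuous (S T : Type) (rS : rel S) (rT : rel T) (f : S -> T) : Prop :=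
  {homo f : s s' / rS s s' >-> rT s s'}.

Record based_image n := BasedImage {
  image :> {fset 'rV[int]_n};
  basepoint : 'rV[int]_n;
  basepoint_in : basepoint \in image }.

Definition bpt n (X : based_image n) : X := [` basepoint_in X].

Definition dconnected n (X : based_image n) : Prop :=
  forall x : X, exists N (a : 'I_N.+1 -> X),
    [/\ dcontinuous (@adj_ord N) (@adj_in n X) a, a ord0 = bpt X & a ord_max = x].

Definition disconnected_complements n (U V : {fset 'rV[int]_n}) : Prop :=
  ~ exists u v, [/\ u \in U `\` (U `&` V), v \in V `\` (U `&` V) & adj u v].

Record based_map m n (X : based_image m) (Y : based_image n) := BasedMap {
  based_map_fun :> X -> Y;
  based_map_cont : dcontinuous (@adj_in m X) (@adj_in n Y) based_map_fun;
  based_map_bpt : based_map_fun (bpt X) = bpt Y }.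

Lemma adj_refl n (x : 'rV[int]_n) : adj x x.
Proof. by apply/forallP => i; rewrite subrr normr0. Qed.

Lemma adj_sym n (x y : 'rV[int]_n) : adj x y = adj y x.
Proof. by apply: eq_forallb => i; rewrite distrC. Qed.

Lemma adj_in_refl n (X : {fset 'rV[int]_n}) (x : X) : adj_in x x.
Proof. exact: adj_refl. Qed.

Lemma adj_ordE N (i j : 'I_N.+1) : adj_ord i j = (i <= j.+1) && (j <= i.+1).
Proof. by rewrite /adj_ord; lia. Qed.

Section Loops.
Context {n : nat} (X : based_image n).

Record loop N := Loop {
  loop_fun :> 'I_N.+1 -> X;
  loop_cont : dcontinuous (@adj_ord N) (@adj_in n X) loop_fun;
  loop_start : loop_fun ord0 = bpt X;
  loop_end : loop_fun ord_max = bpt X }.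

Definition homotopic N (a b : loop N) : Prop :=
  exists R (H : 'I_N.+1 * 'I_R.+1 -> X),
    [/\ 0 < R,
        dcontinuous (adj_prod (@adj_ord N) (@adj_ord R)) (@adj_in n X) H,
        forall s, H (s, ord0) = a s /\ H (s, ord_max) = b s
      & forall t, H (ord0, t) = bpt X /\ H (ord_max, t) = bpt X].

Definition lval N (a : loop N) (i : nat) : X := a (inord i).

Lemma inord_0 N : inord 0 = ord0 :> 'I_N.+1.
Proof. by apply: val_inj; rewrite /= inordK. Qed.

Lemma inord_max N : inord N = ord_max :> 'I_N.+1.
Proof. by apply: val_inj; rewrite /= inordK. Qed.

Lemma lval_ord N (a : loop N) (i : 'I_N.+1) : lval a i = a i.
Proof. by rewrite /lval inord_val. Qed.

Lemma lval0 N (a : loop N) : lval a 0 = bpt X.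
Proof. by rewrite -(loop_start a) -lval_ord. Qed.

Lemma lvalN N (a : loop N) : lval a N = bpt X.
Proof. by rewrite -(loop_end a) -lval_ord. Qed.

Definition ncont N (f : nat -> X) : Prop := forall i j, i <= N -> j <= N ->
  i <= j.+1 -> j <= i.+1 -> adj_in (f i) (f j).

Lemma lval_cont N (a : loop N) : ncont N (lval a).
Proof.
move=> i j iN jN ij ji; apply: loop_cont.
by rewrite adj_ordE !inordK ?ij.
Qed.

Lemma ncont_dcontinuous N f : ncont N f ->
  dcontinuous (@adj_ord N) (@adj_in n X) (fun i => f (nat_of_ord i)).
Proof.
move=> fc i j; rewrite adj_ordE => /andP[ij ji].
by apply: fc => //; rewrite -ltnS.
Qed.

Lemma const_loop_cont N :
  dcontinuous (@adj_ord N) (@adj_in n X) (fun _ => bpt X).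
Proof. by move=> i j _; apply: adj_in_refl. Qed.

Definition const_loop N : loop N := Loop (@const_loop_cont N) erefl erefl.

Lemma rev_loop_cont N (a : loop N) :
  dcontinuous (@adj_ord N) (@adj_in n X) (fun i => a (inord (N - i))).
Proof.
by apply: ncont_dcontinuous (fun i => lval a (N - i)) _ => i j *;
  apply: lval_cont; lia.
Qed.

Lemma rev_loop_start N (a : loop N) : a (inord (N - @ord0 N)) = bpt X.
Proof. by rewrite subn0; apply: lvalN. Qed.

Lemma rev_loop_end N (a : loop N) : a (inord (N - @ord_max N)) = bpt X.
Proof. by rewrite subnn; apply: lval0. Qed.

Definition rev_loop N (a : loop N) : loop N :=
  Loop (rev_loop_cont a) (rev_loop_start a) (rev_loop_end a).

Definition concat_fun M N (a : loop M) (b : loop N) (t : 'I_(M + N.+1).+1) : X :=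
  if t <= M then a (inord t) else b (inord (t - M.+1)).

Lemma concat_cont M N (a : loop M) (b : loop N) :
  dcontinuous (@adj_ord (M + N.+1)) (@adj_in n X) (concat_fun a b).
Proof.
apply: (ncont_dcontinuous
  (f := fun t => if t <= M then lval a t else lval b (t - M.+1))) => i j *.
case: leqP => iM; case: leqP => jM.
- by apply: lval_cont; lia.
- have -> : i = M by lia.
  have -> : j - M.+1 = 0 by lia.
  by rewrite lvalN lval0; apply: adj_in_refl.
- have -> : j = M by lia.
  have -> : i - M.+1 = 0 by lia.
  by rewrite lvalN lval0; apply: adj_in_refl.
- by apply: lval_cont; lia.
Qed.

Lemma concat_start M N (a : loop M) (b : loop N) : concat_fun a b ord0 = bpt X.
Proof. exact: lval0. Qed.

Lemma concat_end M N (a : loop M) (b : loop N) : concat_fun a b ord_max = bpt X.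
Proof.
rewrite /concat_fun /=; have -> : (M + N.+1 <= M) = false by lia.
have -> : M + N.+1 - M.+1 = N by lia.
exact: lvalN.
Qed.

Definition concat M N (a : loop M) (b : loop N) : loop (M + N.+1) :=
  Loop (concat_cont a b) (concat_start a b) (concat_end a b).

(* [subdivide e a] is a \o rho_k with rho_k i = i %/ k. Its length L is kN+k-1;
   the equation L.+1 = k * N.+1 says so and forces k >= 1. Having L as a variable
   makes subdivisions of loops of different lengths comparable without casts. *)
Definition subdivide_fun k N L (e : L.+1 = k * N.+1) (a : loop N) (i : 'I_L.+1) : X :=
  a (inord (i %/ k)).

Lemma subdivide_bound k N L i : L.+1 = k * N.+1 -> i <= L -> i %/ k <= N.
Proof.
move=> e iL; have k0 : 0 < k by lia.
by rewrite -ltnS ltn_divLR // mulnC -e.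
Qed.

Lemma subdivide_gt0 k N L : L.+1 = k * N.+1 -> 0 < k.
Proof. by lia. Qed.

Lemma divn_near k i j : i <= j.+1 -> i %/ k <= (j %/ k).+1.
Proof.
case: k => [|k] ij; first by rewrite !divn0.
apply: (leq_trans (leq_div2r k.+1 ij)).
apply: (@leq_trans ((1 * k.+1 + j) %/ k.+1)); first by apply: leq_div2r; lia.
by rewrite divnMDl // add1n.
Qed.

Lemma subdivide_last k N L : L.+1 = k * N.+1 -> L %/ k = N.
Proof.
move=> e; have k0 := subdivide_gt0 e.
have -> : L = N * k + k.-1 by nia.
by rewrite divnMDl // divn_small ?addn0 // prednK.
Qed.

Lemma subdivide_cont k N L (e : L.+1 = k * N.+1) (a : loop N) :
  dcontinuous (@adj_ord L) (@adj_in n X) (subdivide_fun e a).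
Proof.
apply: (ncont_dcontinuous (f := fun i => lval a (i %/ k))) => i j *.
by apply: lval_cont; rewrite ?divn_near ?(subdivide_bound e).
Qed.

Lemma subdivide_start k N L (e : L.+1 = k * N.+1) (a : loop N) :
  subdivide_fun e a ord0 = bpt X.
Proof. by rewrite /subdivide_fun div0n; apply: lval0. Qed.

Lemma subdivide_end k N L (e : L.+1 = k * N.+1) (a : loop N) :
  subdivide_fun e a ord_max = bpt X.
Proof. by rewrite /subdivide_fun (subdivide_last e); apply: lvalN. Qed.

Definition subdivide k N L (e : L.+1 = k * N.+1) (a : loop N) : loop L :=
  Loop (subdivide_cont e a) (subdivide_start e a) (subdivide_end e a).

Definition subdivision_homotopic M N (a : loop M) (b : loop N) : Prop :=
  exists k l L (ek : L.+1 = k * M.+1) (el : L.+1 = l * N.+1),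
    homotopic (subdivide ek a) (subdivide el b).

Lemma lval_const N i : lval (const_loop N) i = bpt X.
Proof. by []. Qed.

Lemma lval_rev N (a : loop N) i : i <= N -> lval (rev_loop a) i = lval a (N - i).
Proof. by move=> iN; rewrite {1}/lval /= inordK. Qed.

Lemma lval_concat M N (a : loop M) (b : loop N) i : i <= M + N.+1 ->
  lval (concat a b) i = if i <= M then lval a i else lval b (i - M.+1).
Proof. by move=> iN; rewrite {1}/lval /= /concat_fun inordK. Qed.

Lemma lval_subdivide k N L (e : L.+1 = k * N.+1) (a : loop N) i : i <= L ->
  lval (subdivide e a) i = lval a (i %/ k).
Proof. by move=> iL; rewrite {1}/lval /= /subdivide_fun inordK. Qed.

Definition nhomotopic N (f g : nat -> X) : Prop :=
  exists R (h : nat -> nat -> X),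
    [/\ forall s s' t t', s <= N -> s' <= N -> s <= s'.+1 -> s' <= s.+1 ->
          t <= t'.+1 -> t' <= t.+1 -> adj_in (h s t) (h s' t'),
        forall s, s <= N -> h s 0 = f s,
        forall s t, s <= N -> R <= t -> h s t = g s
      & forall t, h 0 t = bpt X /\ h N t = bpt X].

Lemma homotopicP N (a b : loop N) : homotopic a b <-> nhomotopic N (lval a) (lval b).
Proof.
split=> [[R [H [R0 Hc Hab Hb]]]|[R [h [hc h0 h1 hb]]]].
- exists R, (fun s t => H (inord s, inord (minn t R))); split.
  + move=> s s' t t' *; apply: Hc; rewrite /adj_prod /= !adj_ordE !inordK; lia.
  + by move=> s sN; rewrite min0n inord_0 (Hab _).1.
  + by move=> s t sN Rt; rewrite (minn_idPr Rt) inord_max (Hab _).2.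
  + move=> t; rewrite inord_0 inord_max; exact: Hb.
- exists R.+1, (fun p : 'I_N.+1 * 'I_R.+2 => h p.1 p.2); split=> //.
  + move=> [s t] [s' t']; rewrite /adj_prod /= !adj_ordE => /andP[/andP[? ?] /andP[? ?]].
    by apply: hc => //; rewrite -ltnS.
  + by move=> s /=; rewrite h0 ?h1 ?lval_ord // -ltnS.
Qed.

Lemma nhomotopic_ext N f g f' g' :
    (forall i, i <= N -> f i = f' i) -> (forall i, i <= N -> g i = g' i) ->
  nhomotopic N f g -> nhomotopic N f' g'.
Proof.
move=> ff gg [R [h [hc h0 h1 hb]]]; exists R, h; split=> //.
- by move=> s sN; rewrite h0 // ff.
- by move=> s t sN Rt; rewrite h1 // gg.
Qed.

Lemma nhomotopic_refl N f : ncont N f -> f 0 = bpt X -> f N = bpt X ->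
  nhomotopic N f f.
Proof. by move=> fc f0 fN; exists 0, (fun s _ => f s); split=> // *; apply: fc. Qed.

Lemma nhomotopic_sym N f g : nhomotopic N f g -> nhomotopic N g f.
Proof.
move=> [R [h [hc h0 h1 hb]]]; exists R, (fun s t => h s (R - t)); split=> //.
- by move=> *; apply: hc => //; lia.
- by move=> s sN; rewrite subn0 h1.
- by move=> s t sN Rt; rewrite (eqP Rt) h0.
Qed.

Lemma nhomotopic_trans N g f k :
  nhomotopic N f g -> nhomotopic N g k -> nhomotopic N f k.
Proof.
move=> [R [h [hc h0 h1 hb]]] [Q [h' [hc' h0' h1' hb']]].
exists (R + Q), (fun s t => if t <= R then h s t else h' s (t - R)).
have hE s t : s <= N -> R <= t ->
    (if t <= R then h s t else h' s (t - R)) = h' s (t - R).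
  move=> sN Rt; case: leqP => // tR.
  have -> : t = R by lia.
  by rewrite subnn h0' // h1.
split=> //.
- move=> s s' t t' sN s'N ss s's tt t't.
  have [[tR t'R]|[tR t'R]] : (t <= R /\ t' <= R) \/ (R <= t /\ R <= t') by lia.
    by rewrite tR t'R; apply: hc.
  by rewrite !hE //; apply: hc' => //; lia.
- by move=> s t sN Rt; rewrite hE ?h1' //; lia.
- by move=> t; case: leqP.
Qed.

Definition near_on L (s : nat -> nat) : Prop := forall i j, i <= L -> j <= L ->
  i <= j.+1 -> j <= i.+1 -> s i <= (s j).+1.

Lemma nhomotopic_comp N L f g (s : nat -> nat) :
    near_on L s -> (forall i, i <= L -> s i <= N) -> s 0 = 0 -> s L = N ->
  nhomotopic N f g -> nhomotopic L (fun i => f (s i)) (fun i => g (s i)).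
Proof.
move=> sc sN s0 sL [R [h [hc h0 h1 hb]]]; exists R, (fun i => h (s i)); split.
- by move=> *; apply: hc; rewrite ?sN ?sc.
- by move=> i iL; rewrite h0 ?sN.
- by move=> i t iL Rt; rewrite h1 ?sN.
- by move=> t; rewrite s0 sL.
Qed.

(* Two paths in I_M with the same endpoints are homotopic through moves that
   change one value at a time. *)
Lemma nhomotopic_paths_le L M f (s u : nat -> nat) :
    ncont M f -> near_on L s -> near_on L u ->
    (forall i, i <= L -> s i <= u i) -> (forall i, i <= L -> u i <= M) ->
    s 0 = u 0 -> s L = u L -> f (s 0) = bpt X -> f (s L) = bpt X ->
  nhomotopic L (fun i => f (s i)) (fun i => f (u i)).
Proof.
move=> fc; move: {2}(\sum_(i < L.+1) (u i - s i)) (leqnn (\sum_(i < L.+1) (u i - s i))).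
move=> m; elim: m s => [|m IH] s ms sc uc su uM s0 sL fs0 fsL.
- apply: (@nhomotopic_ext _ (fun i => f (u i)) (fun i => f (u i))) => //.
    move=> i iL; congr f; move: ms; rewrite leqn0 sum_nat_eq0 => /forallP.
    by move=> /(_ (inord i)) /=; rewrite inordK //; have := su _ iL; lia.
  apply: nhomotopic_refl; rewrite -?s0 -?sL // => i j *.
  by apply: fc; rewrite ?uM ?uc.
- have [/existsP[i0 lt0]|/existsPn eqsu] :=
      boolP [exists i : 'I_L.+1, s i < u i]; last first.
    apply: IH => //; apply: leq_trans (leq0n m); rewrite leqn0 sum_nat_eq0.
    by apply/forallP => i /=; have := eqsu i; lia.
  case: (@arg_minnP _ i0 (fun i : 'I_L.+1 => s i < u i) (fun i => s i) lt0).
  move=> p pl pmin {i0 lt0}.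
  have pL : p <= L by rewrite -ltnS.
  pose s' i := if i == p :> nat then (s p).+1 else s i.
  have p0 : (p : nat) <> 0 by move=> e; move: pl; rewrite e s0 ltnn.
  have pN : (p : nat) <> L by move=> e; move: pl; rewrite e sL ltnn.
  have nb j : j <= L -> j <= p.+1 -> p <= j.+1 -> s p <= s j.
    move=> jL jp pj; have := pmin (inord j); rewrite inordK //.
    have [lt|le _] := ltnP (s j) (u j); first exact.
    have := uc p j pL jL pj jp; have := su _ jL; lia.
  have ss' i j : i <= L -> j <= L -> i <= j.+1 -> j <= i.+1 ->
      s i <= (s' j).+1 /\ s' i <= (s j).+1.
    move=> iL jL ij ji; rewrite /s'; split.
      by case: eqP => [e|_]; [have := sc i p; rewrite -e; lia | apply: sc].
    by case: eqP => [e|_]; [have := nb j; rewrite -e; lia | apply: sc].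
  have s'c : near_on L s'.
    move=> i j iL jL ij ji; rewrite /s'; case: eqP => [e|_]; case: eqP => [e'|_];
      [by lia | by have := nb j; rewrite -e; lia
      | by have := sc i p; rewrite -e'; lia | exact: sc].
  have s'u i : i <= L -> s' i <= u i.
    by rewrite /s'; case: eqP => [->|_]; [rewrite pl | apply: su].
  have s'0 : s' 0 = s 0 by rewrite /s'; case: eqP => // e; case: p0.
  have s'L : s' L = s L by rewrite /s'; case: eqP => // e; case: pN.
  apply: (@nhomotopic_trans _ (fun i => f (s' i))); last first.
    apply: IH; rewrite ?s'0 ?s'L // -ltnS; apply: leq_trans ms.
    rewrite (bigD1 p) //= [X in _ < X](bigD1 p) //= /s' eqxx.
    rewrite (eq_bigr (fun i : 'I_L.+1 => u i - s i)).
      by rewrite ltn_add2r; lia.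
    by move=> i /negbTE ip; rewrite -(inj_eq val_inj) /= in ip; rewrite ip.
  exists 1, (fun i t => f (if t == 0 then s i else s' i)); split=> //.
  + move=> i j t t' iL jL ij ji _ _.
    have sM : s i <= M /\ s j <= M /\ s' i <= M /\ s' j <= M.
      by have := su _ iL; have := su _ jL; have := s'u _ iL; have := s'u _ jL;
         have := uM _ iL; have := uM _ jL; lia.
    by have := ss' _ _ iL jL ij ji; have := ss' _ _ jL iL ji ij;
       have := sc _ _ iL jL ij ji; have := sc _ _ jL iL ji ij;
       have := s'c _ _ iL jL ij ji; have := s'c _ _ jL iL ji ij;
       case: eqP => _; case: eqP => _ *; apply: fc; lia.
  + by move=> i [].
  + by move=> t; rewrite s'0 s'L !if_same.
Qed.

Lemma nhomotopic_paths L M f (s u : nat -> nat) :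
    ncont M f -> near_on L s -> near_on L u ->
    (forall i, i <= L -> s i <= M) -> (forall i, i <= L -> u i <= M) ->
    s 0 = u 0 -> s L = u L -> f (s 0) = bpt X -> f (s L) = bpt X ->
  nhomotopic L (fun i => f (s i)) (fun i => f (u i)).
Proof.
move=> fc sc uc sM uM e0 eL f0 fL.
have mc : near_on L (fun i => minn (s i) (u i)).
  by move=> i j iL jL ij ji; have := sc i j iL jL ij ji; have := uc i j iL jL ij ji; lia.
have m0 : minn (s 0) (u 0) = s 0 by lia.
have mL : minn (s L) (u L) = s L by lia.
apply: (@nhomotopic_trans _ (fun i => f (minn (s i) (u i)))).
  by apply/nhomotopic_sym/(nhomotopic_paths_le (M := M)) => //;
     rewrite ?m0 ?mL // => i iL; apply: geq_minl.
apply: (nhomotopic_paths_le (M := M)) => //; rewrite ?m0 ?mL // => i iL.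
exact: geq_minr.
Qed.

Lemma near_div k L : near_on L (fun i => i %/ k).
Proof. by move=> i j _ _ ij _; apply: divn_near. Qed.

Lemma subdivision_homotopicP M N (a : loop M) (b : loop N) :
  subdivision_homotopic a b <->
  exists k l L, [/\ L.+1 = k * M.+1, L.+1 = l * N.+1 &
    nhomotopic L (fun i => lval a (i %/ k)) (fun i => lval b (i %/ l))].
Proof.
split=> [[k [l [L [ek [el /homotopicP h]]]]]|[k [l [L [ek el h]]]]].
- exists k, l, L; split=> //; move: h.
  by apply: nhomotopic_ext => i iL; rewrite lval_subdivide.
- exists k, l, L, ek, el; apply/homotopicP; move: h.
  by apply: nhomotopic_ext => i iL; rewrite lval_subdivide.
Qed.

Lemma subdivision_homotopic_eq M N (a : loop M) (b : loop N) :
    M = N -> nhomotopic M (lval a) (lval b) -> subdivision_homotopic a b.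
Proof.
move=> MN h; apply/subdivision_homotopicP; exists 1, 1, M.
split; rewrite ?mul1n ?MN //.
by move: h; apply: nhomotopic_ext => i _; rewrite divn1.
Qed.

Lemma subdivision_homotopic_refl M (a : loop M) : subdivision_homotopic a a.
Proof.
apply: subdivision_homotopic_eq => //.
by apply: nhomotopic_refl; [apply: lval_cont | apply: lval0 | apply: lvalN].
Qed.

Lemma subdivision_homotopic_sym M N (a : loop M) (b : loop N) :
  subdivision_homotopic a b -> subdivision_homotopic b a.
Proof.
move=> /subdivision_homotopicP[k [l [L [ek el h]]]].
by apply/subdivision_homotopicP; exists l, k, L; split=> //; apply: nhomotopic_sym.
Qed.

Lemma nhomotopic_subdivide L f g m L' : L'.+1 = m * L.+1 ->
  nhomotopic L f g ->
  nhomotopic L' (fun i => f (i %/ m)) (fun i => g (i %/ m)).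
Proof.
move=> e; apply: nhomotopic_comp; first exact: near_div.
- by move=> i; apply: subdivide_bound.
- by rewrite div0n.
- exact: subdivide_last.
Qed.

Lemma subdivision_homotopic_trans M N P (a : loop M) (b : loop N) (c : loop P) :
  subdivision_homotopic a b -> subdivision_homotopic b c ->
  subdivision_homotopic a c.
Proof.
move=> /subdivision_homotopicP[k [l [L [ek el h]]]].
move=> /subdivision_homotopicP[k' [l' [L' [ek' el' h']]]].
have k'0 := subdivide_gt0 ek'.
have e1 : (k' * L.+1).-1.+1 = k' * L.+1 by rewrite prednK // muln_gt0 k'0.
have e2 : (k' * L.+1).-1.+1 = l * L'.+1 by rewrite e1 ek' el; lia.
apply/subdivision_homotopicP; exists (k' * k), (l * l'), (k' * L.+1).-1; split.
- by rewrite e1 ek mulnA.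
- by rewrite e2 el' mulnA.
apply: (@nhomotopic_trans _ (fun i => lval b (i %/ (l * k')))).
  have := nhomotopic_subdivide e1 h.
  by apply: nhomotopic_ext => i _; rewrite -divnMA // mulnC.
have := nhomotopic_subdivide e2 h'.
by apply: nhomotopic_ext => i _; rewrite -divnMA.
Qed.

Lemma subdivision_homotopic_reparam M L (a : loop M) (b : loop L) (s : nat -> nat) :
    near_on L s -> (forall i, i <= L -> s i <= M) -> s 0 = 0 -> s L = M ->
    (forall i, i <= L -> lval b i = lval a (s i)) ->
  subdivision_homotopic b a.
Proof.
move=> sc sM s0 sL bE; apply/subdivision_homotopicP.
have e1 : (M.+1 * L.+1).-1.+1 = M.+1 * L.+1 by [].
have e2 : (M.+1 * L.+1).-1.+1 = L.+1 * M.+1 by rewrite e1 mulnC.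
exists M.+1, L.+1, (M.+1 * L.+1).-1; split=> //.
apply: (@nhomotopic_ext _ (fun i => lval a (s (i %/ M.+1)))
                          (fun i => lval a (i %/ L.+1))) => //.
  by move=> i iK; rewrite bE // (subdivide_bound e1).
apply: (nhomotopic_paths (M := M) (s := fun i => s (i %/ M.+1))
                         (u := fun i => i %/ L.+1)).
- exact: lval_cont.
- by move=> i j *; apply: sc; rewrite ?(subdivide_bound e1) ?divn_near.
- exact: near_div.
- by move=> i iK; rewrite sM // (subdivide_bound e1).
- by move=> i iK; rewrite (subdivide_bound e2).
- by rewrite !div0n.
- by rewrite (subdivide_last e1) (subdivide_last e2).
- by rewrite div0n s0 lval0.
- by rewrite (subdivide_last e1) sL lvalN.
Qed.

Lemma nhomotopic_concat M N (a a' : loop M) (b b' : loop N) :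
  nhomotopic M (lval a) (lval a') -> nhomotopic N (lval b) (lval b') ->
  nhomotopic (M + N.+1) (lval (concat a b)) (lval (concat a' b')).
Proof.
move=> [R [h [hc h0 h1 hb]]] [Q [k [kc k0 k1 kb]]].
exists (R + Q), (fun i t => if i <= M then h i t else k (i - M.+1) t); split.
- move=> i j t t' *; case: leqP => iM; case: leqP => jM.
  + by apply: hc => //; lia.
  + have -> : i = M by lia.
    have -> : j - M.+1 = 0 by lia.
    by rewrite (hb _).2 (kb _).1; apply: adj_in_refl.
  + have -> : j = M by lia.
    have -> : i - M.+1 = 0 by lia.
    by rewrite (hb _).2 (kb _).1; apply: adj_in_refl.
  + by apply: kc => //; lia.
- move=> i iN; rewrite lval_concat //; case: leqP => iM; first exact: h0.
  by apply: k0; lia.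
- move=> i t iN Rt; rewrite lval_concat //; case: leqP => iM.
    by apply: h1; lia.
  by apply: k1; lia.
- move=> t; split; first exact: (hb t).1.
  have -> : (M + N.+1 <= M) = false by lia.
  have -> : M + N.+1 - M.+1 = N by lia.
  exact: (kb t).2.
Qed.

Lemma concat_subdivide k l M N K L (ek : K.+1 = k * M.+1) (el : L.+1 = l * N.+1)
    (a : loop M) (b : loop N) :
  subdivision_homotopic (concat (subdivide ek a) (subdivide el b)) (concat a b).
Proof.
apply: (subdivision_homotopic_reparam
  (s := fun i => if i <= K then i %/ k else M.+1 + (i - K.+1) %/ l)).
- move=> i j iL jL ij ji; case: (leqP i K) => iK; case: (leqP j K) => jK.
  + exact: divn_near.
  + by have := subdivide_bound ek iK; move: (i %/ k) (_ %/ l) => p q; lia.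
  + have -> : j = K by lia.
    have -> : i - K.+1 = 0 by lia.
    by rewrite div0n addn0 (subdivide_last ek).
  + have := @divn_near l (i - K.+1) (j - K.+1).
    by move: (_ %/ l) (_ %/ l) => p q; lia.
- move=> i iL; case: (leqP i K) => iK; first by have := subdivide_bound ek iK; move: (i %/ k) => p; lia.
  have iL' : i - K.+1 <= L by lia.
  by have := subdivide_bound el iL'; move: (_ %/ l) => p; lia.
- by rewrite div0n.
- have -> : (K + L.+1 <= K) = false by lia.
  have -> : K + L.+1 - K.+1 = L by lia.
  by rewrite (subdivide_last el) addSnnS.
- move=> i iL; rewrite lval_concat //; case: leqP => iK.
    have := subdivide_bound ek iK => dK.
    by rewrite lval_subdivide // lval_concat ?dK // (leq_trans dK) ?leq_addr.
  have iL' : i - K.+1 <= L by lia.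
  have := subdivide_bound el iL' => dL.
  rewrite lval_subdivide // lval_concat; last by rewrite addSnnS leq_add2l.
  by rewrite addSn ltnNge leq_addr /= subSS addKn.
Qed.

Lemma subdivision_homotopic_concat M M' N N' (a : loop M) (a' : loop M')
    (b : loop N) (b' : loop N') :
  subdivision_homotopic a a' -> subdivision_homotopic b b' ->
  subdivision_homotopic (concat a b) (concat a' b').
Proof.
move=> [k [k' [K [ek [ek' /homotopicP ha]]]]] [l [l' [L [el [el' /homotopicP hb]]]]].
have h1 := subdivision_homotopic_sym (concat_subdivide ek el a b).
have h2 := concat_subdivide ek' el' a' b'.
apply: (subdivision_homotopic_trans h1); apply: subdivision_homotopic_trans h2.
by apply: subdivision_homotopic_eq => //; apply: nhomotopic_concat.
Qed.

Lemma subdivision_homotopic_rev M N (a : loop M) (b : loop N) :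
  subdivision_homotopic a b -> subdivision_homotopic (rev_loop a) (rev_loop b).
Proof.
move=> /subdivision_homotopicP[k [l [L [ek el h]]]].
apply/subdivision_homotopicP; exists k, l, L; split=> //.
have revE k' P (c : loop P) : L.+1 = k' * P.+1 -> forall i, i <= L ->
    lval c ((L - i) %/ k') = lval (rev_loop c) (i %/ k').
  move=> e i iL; rewrite lval_rev ?(subdivide_bound e) //; congr lval.
  have k0 := subdivide_gt0 e; have := divn_eq i k'; have := ltn_pmod i k0.
  have := subdivide_bound e iL.
  move: (i %/ k') (i %% k') => q r qP rk ->.
  have -> : L - (q * k' + r) = (P - q) * k' + (k' - r.+1) by nia.
  by rewrite divnMDl // divn_small ?addn0 //; lia.
have [R [H [Hc H0 H1 Hb]]] := h.
apply: (nhomotopic_ext (revE _ _ a ek) (revE _ _ b el)).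
exists R, (fun i t => H (L - i) t); split.
- by move=> *; apply: Hc => //; lia.
- by move=> i iL; rewrite H0 // leq_subr.
- by move=> i t iL Rt; rewrite H1 // leq_subr.
- by move=> t; rewrite subn0 subnn; have [] := Hb t.
Qed.

Lemma subdivision_homotopic_const M N :
  subdivision_homotopic (const_loop M) (const_loop N).
Proof.
have h K : subdivision_homotopic (const_loop K) (const_loop 0).
  exact: (subdivision_homotopic_reparam (s := fun=> 0)).
exact: (subdivision_homotopic_trans (h M) (subdivision_homotopic_sym (h N))).
Qed.

Lemma concat_constr M (a : loop M) :
  subdivision_homotopic (concat a (const_loop 0)) a.
Proof.
apply: (subdivision_homotopic_reparam (s := fun i => minn i M)).
- by move=> i j *; lia.
- by move=> i _; exact: geq_minr.
- by rewrite min0n.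
- lia.
- move=> i iM; rewrite lval_concat //; case: leqP => // iM'.
  by rewrite lval_const lvalN.
Qed.

Lemma concat_constl M (a : loop M) :
  subdivision_homotopic (concat (const_loop 0) a) a.
Proof.
apply: (subdivision_homotopic_reparam (s := fun i => i.-1)).
- by move=> i j *; lia.
- by move=> i; lia.
- by [].
- lia.
- move=> [|i] iM; rewrite lval_concat //=; first by rewrite lval0.
  by rewrite subn1.
Qed.

Lemma concatA M N P (a : loop M) (b : loop N) (c : loop P) :
  subdivision_homotopic (concat a (concat b c)) (concat (concat a b) c).
Proof.
apply: subdivision_homotopic_eq; first by lia.
apply: (@nhomotopic_ext _ (lval (concat a (concat b c)))
                          (lval (concat a (concat b c)))) => //; last first.
  by apply: nhomotopic_refl; [apply: lval_cont | apply: lval0 | apply: lvalN].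
move=> i iL; rewrite lval_concat // [RHS]lval_concat; last by lia.
case: leqP => iM.
  have iMN : i <= M + N.+1 by lia.
  by rewrite iMN lval_concat // iM.
rewrite lval_concat; last by lia.
case: leqP => iN.
  have iMN : i <= M + N.+1 by lia.
  by rewrite iMN lval_concat // leqNgt iM.
have -> : (i <= M + N.+1) = false by lia.
by congr lval; lia.
Qed.

Lemma concat_revr M (a : loop M) (N : nat) :
  subdivision_homotopic (concat a (rev_loop a)) (const_loop N).
Proof.
pose L := M + M.+1.
apply: (subdivision_homotopic_trans (N := L) (b := const_loop L)); last first.
  exact: subdivision_homotopic_const.
apply: subdivision_homotopic_eq => //.
apply: (@nhomotopic_ext _ (fun i => lval a (minn i (L - i))) (fun i => lval a 0)).
- move=> i iL; rewrite lval_concat //; case: leqP => iM.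
    by congr lval; rewrite /L; lia.
  by rewrite lval_rev; [congr lval|]; rewrite /L in iL *; lia.
- by move=> i iL; rewrite lval0.
apply: (nhomotopic_paths (M := M) (s := fun i => minn i (L - i)) (u := fun=> 0)) => //.
- exact: lval_cont.
- by move=> i j *; lia.
- by move=> i _; rewrite /L; lia.
all: by rewrite ?subnn ?minn0 ?min0n ?lval0 //; lia.
Qed.

Lemma rev_loopK M (a : loop M) : subdivision_homotopic (rev_loop (rev_loop a)) a.
Proof.
apply: (subdivision_homotopic_reparam (s := fun i => i)) => //.
by move=> i iM; rewrite !lval_rev ?leq_subr // subKn.
Qed.

Lemma concat_revl M (a : loop M) (N : nat) :
  subdivision_homotopic (concat (rev_loop a) a) (const_loop N).
Proof.
apply: subdivision_homotopic_trans (concat_revr (rev_loop a) N).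
apply: subdivision_homotopic_concat; first exact: subdivision_homotopic_refl.
exact: subdivision_homotopic_sym (rev_loopK a).
Qed.

HB.instance Definition _ N := gen_eqMixin (loop N).
HB.instance Definition _ N := gen_choiceMixin (loop N).

Definition loops : choiceType := {N : nat & loop N}.

Definition mk_loops N (a : loop N) : loops := Tagged loop a.

Definition loops_equiv (a b : loops) : bool :=
  `[< subdivision_homotopic (tagged a) (tagged b) >].

Lemma loops_equiv_refl : reflexive loops_equiv.
Proof. by move=> a; apply/asboolP; apply: subdivision_homotopic_refl. Qed.

Lemma loops_equiv_sym : symmetric loops_equiv.
Proof.
by move=> a b; apply/asboolP/asboolP; apply: subdivision_homotopic_sym.
Qed.

Lemma loops_equiv_trans : transitive loops_equiv.
Proof.
move=> b a c /asboolP ab /asboolP bc; apply/asboolP.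
exact: subdivision_homotopic_trans ab bc.
Qed.

Canonical loops_equivRel :=
  EquivRel loops_equiv loops_equiv_refl loops_equiv_sym loops_equiv_trans.

Definition pi1 : Type := {eq_quot loops_equiv}.
HB.instance Definition _ := EqQuotient.on pi1.
HB.instance Definition _ := Choice.on pi1.

Definition loop_class N (a : loop N) : pi1 := \pi_pi1 (mk_loops a).

Lemma loop_classP M N (a : loop M) (b : loop N) :
  loop_class a = loop_class b <-> subdivision_homotopic a b.
Proof.
split=> [/eqmodP/asboolP //|ab].
by apply/eqmodP/asboolP.
Qed.

Lemma loop_class_ind (P : pi1 -> Prop) :
  (forall N (a : loop N), P (loop_class a)) -> forall c, P c.
Proof. by move=> Pcl c; rewrite -[c]reprK; case: (repr c) => N a; apply: Pcl. Qed.

Lemma repr_class N (a : loop N) :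
  subdivision_homotopic (tagged (repr (loop_class a))) a.
Proof.
apply/loop_classP; have -> (l : loops) : loop_class (tagged l) = \pi_pi1 l by case: l.
exact: reprK.
Qed.

Definition pi1_one : pi1 := loop_class (const_loop 0).
Definition pi1_inv (c : pi1) : pi1 := loop_class (rev_loop (tagged (repr c))).
Definition pi1_mul (c d : pi1) : pi1 :=
  loop_class (concat (tagged (repr c)) (tagged (repr d))).

Lemma pi1_invE N (a : loop N) : pi1_inv (loop_class a) = loop_class (rev_loop a).
Proof. by apply/loop_classP/subdivision_homotopic_rev/repr_class. Qed.

Lemma pi1_mulE M N (a : loop M) (b : loop N) :
  pi1_mul (loop_class a) (loop_class b) = loop_class (concat a b).
Proof. by apply/loop_classP/subdivision_homotopic_concat; apply: repr_class. Qed.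

Lemma pi1_mulA : associative pi1_mul.
Proof.
elim/loop_class_ind => M a; elim/loop_class_ind => N b; elim/loop_class_ind => P c.
by rewrite !pi1_mulE; apply/loop_classP/concatA.
Qed.

Lemma pi1_mul1 : left_id pi1_one pi1_mul.
Proof.
by elim/loop_class_ind => M a; rewrite pi1_mulE; apply/loop_classP/concat_constl.
Qed.

Lemma pi1_mulr1 : right_id pi1_one pi1_mul.
Proof.
by elim/loop_class_ind => M a; rewrite pi1_mulE; apply/loop_classP/concat_constr.
Qed.

Lemma pi1_mulV : left_inverse pi1_one pi1_inv pi1_mul.
Proof.
elim/loop_class_ind => M a.
by rewrite pi1_invE pi1_mulE; apply/loop_classP/concat_revl.
Qed.

Lemma pi1_mulrV : right_inverse pi1_one pi1_inv pi1_mul.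
Proof.
elim/loop_class_ind => M a.
by rewrite pi1_invE pi1_mulE; apply/loop_classP/concat_revr.
Qed.

HB.instance Definition _ :=
  isGroup.Build pi1 pi1_mulA pi1_mul1 pi1_mulr1 pi1_mulV pi1_mulrV.

Lemma loop_classM M N (a : loop M) (b : loop N) :
  (loop_class a * loop_class b)%g = loop_class (concat a b).
Proof. exact: pi1_mulE. Qed.

Lemma loop_classV N (a : loop N) : ((loop_class a)^-1)%g = loop_class (rev_loop a).
Proof. exact: pi1_invE. Qed.

Lemma loop_class1 N : loop_class (const_loop N) = 1%g.
Proof. exact/loop_classP/subdivision_homotopic_const. Qed.

End Loops.

Section Induced.
Context {m n : nat} (X : based_image m) (Y : based_image n) (f : based_map X Y).

Lemma map_loop_cont N (a : loop X N) :
  dcontinuous (@adj_ord N) (@adj_in n Y) (f \o a).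
Proof. by move=> i j ij; apply/based_map_cont/loop_cont. Qed.

Lemma map_loop_start N (a : loop X N) : (f \o a) ord0 = bpt Y.
Proof. by rewrite /= loop_start based_map_bpt. Qed.

Lemma map_loop_end N (a : loop X N) : (f \o a) ord_max = bpt Y.
Proof. by rewrite /= loop_end based_map_bpt. Qed.

Definition map_loop N (a : loop X N) : loop Y N :=
  Loop (map_loop_cont a) (map_loop_start a) (map_loop_end a).

Lemma map_loop_homotopic M N (a : loop X M) (b : loop X N) :
  subdivision_homotopic a b -> subdivision_homotopic (map_loop a) (map_loop b).
Proof.
move=> [k [l [L [ek [el [R [H [R0 Hc Hab Hb]]]]]]]].
exists k, l, L, ek, el, R, (f \o H); split=> //.
- by move=> p q pq; apply/based_map_cont/Hc.
- by move=> s /=; have [-> ->] := Hab s.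
- by move=> t /=; have [-> ->] := Hb t; rewrite based_map_bpt.
Qed.

Definition pi1_map (c : pi1 X) : pi1 Y := loop_class (map_loop (tagged (repr c))).

Lemma pi1_mapE N (a : loop X N) : pi1_map (loop_class a) = loop_class (map_loop a).
Proof. by apply/loop_classP/map_loop_homotopic/repr_class. Qed.

Lemma pi1_map_morph : {morph pi1_map : c d / (c * d)%g}.
Proof.
apply: loop_class_ind => M a; apply: loop_class_ind => N b.
rewrite loop_classM !pi1_mapE loop_classM; apply/loop_classP.
apply: subdivision_homotopic_eq => //.
apply: (@nhomotopic_ext _ _ _ (lval (map_loop (concat a b)))
                              (lval (map_loop (concat a b)))) => //; last first.
  by apply: nhomotopic_refl; [apply: lval_cont | apply: lval0 | apply: lvalN].
by move=> i iL; rewrite [RHS]lval_concat // /lval /= /concat_fun inordK //; case: ifP.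
Qed.

HB.instance Definition _ := isMultiplicative.Build (pi1 X) (pi1 Y) pi1_map pi1_map_morph.

End Induced.

Section Inclusion.
Context {n : nat} (X Y : {fset 'rV[int]_n}) (sXY : X `<=` Y).
Context (x0 : 'rV[int]_n) (x0X : x0 \in X) (x0Y : x0 \in Y).

Lemma inclusion_cont : dcontinuous (@adj_in n X) (@adj_in n Y) (fincl sXY).
Proof. by []. Qed.

Lemma inclusion_bpt : fincl sXY (bpt (BasedImage x0X)) = bpt (BasedImage x0Y).
Proof. exact: val_inj. Qed.

Definition inclusion : based_map (BasedImage x0X) (BasedImage x0Y) :=
  BasedMap (X := BasedImage x0X) (Y := BasedImage x0Y) inclusion_cont inclusion_bpt.

End Inclusion.

(* A [groupType] carries a choice structure, which is no restriction on the
   groups quantified over: [gen_choiceMixin] provides one on any type. *)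
Definition is_pushout (A B C P : groupType)
    (i1 : {multiplicative A -> B}) (i2 : {multiplicative A -> C})
    (p1 : {multiplicative B -> P}) (p2 : {multiplicative C -> P}) : Prop :=
  p1 \o i1 =1 p2 \o i2 /\
  forall (G : groupType) (h1 : {multiplicative B -> G}) (h2 : {multiplicative C -> G}),
    h1 \o i1 =1 h2 \o i2 ->
    exists phi : {multiplicative P -> G},
      [/\ phi \o p1 =1 h1, phi \o p2 =1 h2
        & forall phi' : {multiplicative P -> G},
            phi' \o p1 =1 h1 -> phi' \o p2 =1 h2 -> phi' =1 phi].

(* Main.v *)
Require Import Defs.
From HB Require Import structures.
From mathcomp Require Import all_boot all_order all_algebra finmap boolp zify.

Set Implicit Arguments.
Unset Strict Implicit.
Unset Printing Implicit Defensive.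

Local Open Scope fset_scope.
Local Open Scope nat_scope.

(** The homotopy relation only sees the cliques of a digital image: the four
    corners of a unit square of a homotopy are pairwise adjacent.  A clique of
    [U `|` V] lies in [U] or in [V] ([clique_cover]), since a point outside [V]
    and a point outside [U] would be an adjacent pair of the two complements.  So
    no subdivision of a homotopy into small pieces is needed, and the
    theorem becomes a statement about cocycles on edges.

    Choose for every point [x] a path [gam x] from the basepoint that stays in
    [U `&` V], [U] or [V] whenever [x] lies there ([adapted_path_system]).  In any
    image [X] among the four, an edge [x ~ y] then has a class [edge X x y] in
    [pi1 X]: go along [gam x], cross the edge, come back along [gam y].  Two
    facts hold.  On pairwise adjacent points, [edge x y * edge y z = edge x z]
    ([edge_cocycle]); this is an instance of [join_mul], which cancels a
    path run backwards and then forwards.  The class of a loop is the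
    product of the classes of its edges ([prod_edge_loop]), because consecutive
    factors cancel along the same [gam x].

    Uniqueness follows at once: every edge of [U `|` V] lies in [U] or in [V], so
    every class is a product of images of classes of [U] and of [V].

    For existence, set [w x y = h1 (edge U x y)] on edges of [U] and
    [w x y = h2 (edge V x y)] on the others.  On edges of [U `&` V] the two
    formulas agree because [h1 \o i1 = h2 \o i2], so [w] satisfies the cocycle
    rule on every clique.  The product of [w] along a loop is then
    invariant under homotopy (two adjacent rows of a homotopy form a ladder of
    cliques, [walk_ladder]) and under subdivision (repeated points contribute
    [w x x = 1]), and it is multiplicative: this is [phi] ([cocycle_hom]).  The
    product formula in [pi1 U] and [pi1 V] gives [phi \o psi1 = h1] and
    [phi \o psi2 = h2]. *)

(** * Loops as functions into the lattice *)

Section AmbientPaths.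
Context {n : nat}.
Implicit Types (X Y : based_image n) (f g p q r : nat -> 'rV[int]_n).

(** Paths are functions [nat -> 'rV[int]_n] read on [0..N], rather than maps into
    the finite type of points of [X]: the same function can then be viewed in
    several images, and inclusions act on it as the identity. *)
Definition is_path X N f : Prop :=
  [/\ f 0 = basepoint X, forall i, i <= N -> f i \in Defs.image X
    & forall i, i < N -> adj (f i) (f i.+1)].

Definition is_loop X N f : Prop := is_path X N f /\ f N = basepoint X.

Lemma path_adj X N f i j : is_path X N f ->
  i <= N -> j <= N -> i <= j.+1 -> j <= i.+1 -> adj (f i) (f j).
Proof.
move=> [_ _ fA] iN jN ij ji.
have [e|[e|->]] : j = i.+1 \/ i = j.+1 \/ i = j by lia.
- by rewrite e; apply: fA; lia.
- by rewrite e adj_sym; apply: fA; lia.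
- exact: adj_refl.
Qed.

Lemma is_path_take X N f k : is_path X N f -> k <= N -> is_path X k f.
Proof. by move=> [f0 fX fA] kN; split=> // i ik; [apply: fX | apply: fA]; lia. Qed.

Lemma is_path_reparam X M L f g (s : nat -> nat) : is_path X M f ->
    near_on L s -> (forall i, i <= L -> s i <= M) -> s 0 = 0 ->
    (forall i, i <= L -> g i = f (s i)) ->
  is_path X L g.
Proof.
move=> fP sc sM s0 gE; have [f0 fX _] := fP; split.
- by rewrite gE // s0.
- by move=> i iL; rewrite gE // fX // sM.
- by move=> i iL; rewrite !gE ?(ltnW iL) //; apply: (path_adj fP);
    rewrite ?sM ?sc ?(ltnW iL) //; lia.
Qed.

Lemma is_loop_reparam X M L f g (s : nat -> nat) : is_loop X M f ->
    near_on L s -> (forall i, i <= L -> s i <= M) -> s 0 = 0 -> s L = M ->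
    (forall i, i <= L -> g i = f (s i)) ->
  is_loop X L g.
Proof.
move=> [fP fM] sc sM s0 sL gE; split; last by rewrite gE // sL.
exact: is_path_reparam fP sc sM s0 gE.
Qed.

Lemma loop_path X N (a : loop X N) : is_loop X N (fun i => val (lval a i)).
Proof.
split; last by rewrite lvalN.
split=> [|i _|i iN]; [by rewrite lval0 | exact: valP |].
by apply: (@lval_cont _ _ _ a); lia.
Qed.

Lemma loop_of_subproof X N f : is_loop X N f ->
  {a : loop X N | forall i, i <= N -> val (lval a i) = f i}.
Proof.
move=> [fP fN]; have [f0 fX _] := fP.
pose F i : Defs.image X := insubd (bpt X) (f i).
have FE i : i <= N -> val (F i) = f i by move=> iN; rewrite insubdK // fX.
have Fc : ncont N F.
  by move=> i j iN jN ij ji; rewrite /adj_in !FE //; apply: (path_adj fP).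
have F0 : F 0 = bpt X by apply: val_inj; rewrite FE.
have FN : F N = bpt X by apply: val_inj; rewrite FE.
exists (Loop (ncont_dcontinuous Fc) F0 FN) => i iN.
by rewrite /lval /= inordK // FE.
Qed.

(** The constant loop is a default value, so that classes of functions can be
    written down before the function is known to be a loop. *)
Definition loop_of X N f : loop X N :=
  if pselect (is_loop X N f) is left fL then sval (loop_of_subproof fL)
  else const_loop X N.

Lemma loop_ofE X N f i : is_loop X N f -> i <= N ->
  val (lval (loop_of X N f) i) = f i.
Proof.
by move=> fL; rewrite /loop_of; case: pselect => // h; case: (loop_of_subproof h) => a /= aE /aE.
Qed.

Definition fclass X N f : pi1 X := loop_class (loop_of X N f).

Lemma loop_class_reparam X M L (a : loop X M) (b : loop X L) (s : nat -> nat) :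
    near_on L s -> (forall i, i <= L -> s i <= M) -> s 0 = 0 -> s L = M ->
    (forall i, i <= L -> val (lval b i) = val (lval a (s i))) ->
  loop_class b = loop_class a.
Proof.
move=> sc sM s0 sL e; apply/loop_classP.
apply: (subdivision_homotopic_reparam sc) => // i iL.
by apply: val_inj; apply: e.
Qed.

Lemma fclass_reparam X M L f g (s : nat -> nat) : is_loop X M f ->
    near_on L s -> (forall i, i <= L -> s i <= M) -> s 0 = 0 -> s L = M ->
    (forall i, i <= L -> g i = f (s i)) ->
  fclass X L g = fclass X M f.
Proof.
move=> fL sc sM s0 sL gE; apply: (loop_class_reparam sc) => // i iL.
by rewrite !loop_ofE ?gE ?sM //; apply: (is_loop_reparam fL sc).
Qed.

Lemma loop_class_fclass X N (a : loop X N) f :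
  (forall i, i <= N -> f i = val (lval a i)) -> loop_class a = fclass X N f.
Proof.
move=> fE; apply: (@loop_class_reparam _ _ _ _ _ id) => // i iN.
rewrite loop_ofE ?fE //.
by apply: (is_loop_reparam (s := id) (loop_path a)) => // i' j *.
Qed.

Lemma fclassM X M N f g : is_loop X M f -> is_loop X N g ->
  (fclass X M f * fclass X N g)%g =
    fclass X (M + N.+1) (fun i => if i <= M then f i else g (i - M.+1)).
Proof.
move=> fL gL; rewrite loop_classM; apply: loop_class_fclass => i iN.
by rewrite lval_concat //; case: leqP => iM; rewrite loop_ofE //; lia.
Qed.

(** Adjacency being symmetric, only vertical steps and steps from [i] to [i.+1]
    have to be checked. *)
Lemma fclass_homotopy X N R (h : nat -> nat -> 'rV[int]_n) :
    (forall i t, i <= N -> h i t \in Defs.image X) ->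
    (forall i t u, i <= N -> t <= u.+1 -> u <= t.+1 -> adj (h i t) (h i u)) ->
    (forall i t u, i < N -> t <= u.+1 -> u <= t.+1 -> adj (h i t) (h i.+1 u)) ->
    (forall t, h 0 t = basepoint X) -> (forall t, h N t = basepoint X) ->
  fclass X N (h^~ 0) = fclass X N (h^~ R).
Proof.
move=> hX hv hh h0 hN.
have hL t : is_loop X N (h^~ t).
  by split=> //; split=> // i iN; [apply: hX | apply: hh].
apply/loop_classP/subdivision_homotopic_eq => //.
pose H i t : Defs.image X := insubd (bpt X) (h i (minn t R)).
have HE i t : i <= N -> val (H i t) = h i (minn t R).
  by move=> iN; rewrite insubdK // hX.
exists R, H; split.
- move=> i j t u iN jN ij ji tu ut; rewrite /adj_in !HE //.
  have [e|[e|e]] : j = i.+1 \/ i = j.+1 \/ i = j by lia.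
  + by rewrite e; apply: hh; lia.
  + by rewrite e adj_sym; apply: hh; lia.
  + by rewrite e; apply: hv; lia.
- by move=> i iN; apply: val_inj; rewrite HE // loop_ofE // min0n.
- by move=> i t iN Rt; apply: val_inj; rewrite HE // loop_ofE //; congr h; lia.
- by move=> t; split; apply: val_inj; rewrite HE.
Qed.

(** The path [p] followed by the reverse of [q]. *)
Definition join M p N q (i : nat) : 'rV[int]_n :=
  if i <= M then p i else q (M + N.+1 - i).

Lemma join_loop X M p N q : is_path X M p -> is_path X N q ->
  adj (p M) (q N) -> is_loop X (M + N.+1) (join M p N q).
Proof.
move=> [p0 pX pA] [q0 qX qA] pq; split; last first.
  by rewrite /join subnn q0; case: leqP => //; lia.
rewrite /join; split=> // i iL.
  by case: leqP => iM; [apply: pX | apply: qX; lia].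
case: (leqP i.+1 M) => iM; first by rewrite (ltnW iM); apply: pA.
case: leqP => iM'.
  have -> : i = M by lia.
  by have -> : M + N.+1 - M.+1 = N by lia.
have -> : M + N.+1 - i = (M + N.+1 - i.+1).+1 by lia.
by rewrite adj_sym; apply: qA; lia.
Qed.

(** In the concatenation [p] runs forwards, [q] backwards, [q] forwards, [r]
    backwards.  The middle excursion shrinks to the end point of [q], which can
    then be replaced by the end point of [p] since the three end points form a
    clique; what remains is [join p r] with a pause at the end of [p]. *)
Lemma join_mul X M p N q P r :
    is_path X M p -> is_path X N q -> is_path X P r ->
    adj (p M) (q N) -> adj (q N) (r P) -> adj (p M) (r P) ->
  (fclass X (M + N.+1) (join M p N q) * fclass X (N + P.+1) (join N q P r))%g
    = fclass X (M + P.+1) (join M p P r).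
Proof.
move=> pP qP rP pq qr pr; have pqL := join_loop pP qP pq.
have qrL := join_loop qP rP qr; have prL := join_loop pP rP pr.
rewrite fclassM //; set L := _ + _.+1.
(* In the middle block [M < i <= M + (N + N.+2)] the concatenation sits at
   [q (d i)], where [d i] goes from [N] to [0] and back to [N].  At time [t <= N]
   this is cut off below at [t], which is constantly [q N] when [t = N]; the
   last step, to time [N.+1], moves the block to [p M]. *)
pose d i := M + N.+1 - i + (i - (M + N.+2)).
pose mid i t := if t <= N then q (maxn (d i) t) else p M.
pose h i t := if i <= M then p i else
              if i <= M + (N + N.+2) then mid i t else r (L - i).
have [p0 pX pA] := pP; have [q0 qX qA] := qP; have [r0 rX rA] := rP.
have hX i t : i <= L -> h i t \in Defs.image X.
  move=> iL; rewrite /h /mid; case: leqP => iM; first exact: pX.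
  case: leqP => iN; last by apply: rX; lia.
  by case: leqP => tN; [apply: qX; rewrite /d; lia | apply: pX].
have hv i t u : i <= L -> t <= u.+1 -> u <= t.+1 -> adj (h i t) (h i u).
  move=> iL tu ut; rewrite /h /mid; case: leqP => iM; first exact: adj_refl.
  case: leqP => iN; last exact: adj_refl.
  case: (leqP t N) => tN; case: (leqP u N) => uN.
  - by apply: (path_adj qP); rewrite /d; lia.
  - by have -> : maxn (d i) t = N; [rewrite /d; lia | rewrite adj_sym].
  - by have -> : maxn (d i) u = N; [rewrite /d; lia |].
  - exact: adj_refl.
have hh i t u : i < L -> t <= u.+1 -> u <= t.+1 -> adj (h i t) (h i.+1 u).
  move=> iL tu ut; rewrite /h /mid; case: (leqP i.+1 M) => iM.
    by rewrite (ltnW iM); apply: pA.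
  case: (leqP i M) => iM'.
    have -> : i = M by lia.
    have -> : M.+1 <= M + (N + N.+2) by lia.
    case: leqP => uN; last exact: adj_refl.
    by have -> : maxn (d M.+1) u = N by rewrite /d; lia.
  case: (leqP i.+1 (M + (N + N.+2))) => iN.
    rewrite (ltnW iN); case: (leqP t N) => tN; case: (leqP u N) => uN.
    - by apply: (path_adj qP); rewrite /d; lia.
    - by have -> : maxn (d i) t = N; [rewrite /d; lia | rewrite adj_sym].
    - by have -> : maxn (d i.+1) u = N; [rewrite /d; lia |].
    - exact: adj_refl.
  case: (leqP i (M + (N + N.+2))) => iN'; last first.
    by apply: (path_adj rP); lia.
  have -> : L - i.+1 = P by rewrite /L; lia.
  case: leqP => tN //.
  by have -> : maxn (d i) t = N by rewrite /d; lia.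
have h0 t : h 0 t = basepoint X by [].
have hL t : h L t = basepoint X.
  rewrite /h subnn r0; have -> : (L <= M) = false by lia.
  by have -> : (L <= M + (N + N.+2)) = false by lia.
transitivity (fclass X L (h^~ 0)).
  apply: (@fclass_reparam _ L _ _ _ id) => // [|i iL].
    by split=> //; split=> // i iL; [apply: hX | apply: hh].
  rewrite /h /join /mid /d.
  case: (leqP i (M + N.+1)) => i1.
    case: leqP => i2 //; have -> : i <= M + (N + N.+2) by lia.
    by rewrite leq0n; congr q; lia.
  have -> : (i <= M) = false by lia.
  case: (leqP (i - _) N) => i2.
    have -> : i <= M + (N + N.+2) by lia.
    by rewrite leq0n; congr q; lia.
  have -> : (i <= M + (N + N.+2)) = false by lia.
  by congr r; rewrite /L; lia.
rewrite (@fclass_homotopy _ _ N.+1) //.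
pose s i := if i <= M then i else
            if i <= M + (N + N.+2) then M else i - (N + N.+2).
apply: (fclass_reparam prL (s := s)); rewrite /s.
- move=> i j _ _; case: (leqP i M); case: (leqP j M);
    case: (leqP i (M + (N + N.+2))); case: (leqP j (M + (N + N.+2))); lia.
- move=> i; rewrite /L; case: (leqP i M); case: (leqP i (M + (N + N.+2))); lia.
- by [].
- by case: (leqP L M); case: (leqP L (M + (N + N.+2))); rewrite /L; lia.
- move=> i iL; rewrite /h /join /mid ltnn.
  case: leqP => iM; first by rewrite iM.
  case: leqP => iN; first by rewrite leqnn.
  have -> : (i - (N + N.+2) <= M) = false by lia.
  by congr r; rewrite /L; lia.
Qed.

(** When [q] ends at [p M.+1], the longer loop only repeats that point. *)
Lemma join_last X M p N q : is_path X M.+1 p -> is_path X N q ->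
    q N = p M.+1 ->
  fclass X (M.+1 + N.+1) (join M.+1 p N q) = fclass X (M + N.+1) (join M p N q).
Proof.
move=> pP qP e; have [_ _ pA] := pP.
have jL : is_loop X (M + N.+1) (join M p N q).
  by apply: join_loop qP _; [apply: is_path_take pP _ | rewrite e; apply: pA].
apply: (fclass_reparam jL (s := fun i => if i <= M.+1 then i else i.-1)).
- by move=> i j _ _; case: (leqP i M.+1); case: (leqP j M.+1); lia.
- by move=> i; case: (leqP i M.+1); lia.
- by [].
- by case: (leqP (M.+1 + N.+1) M.+1); lia.
- move=> i iL; rewrite /join; case: (leqP i M.+1) => i1.
    case: leqP => i2 //; have -> : i = M.+1 by lia.
    by rewrite -e; congr q; lia.
  have -> : (i.-1 <= M) = false by lia.
  by congr q; lia.
Qed.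

End AmbientPaths.

(** * Classes of edges *)

Section Edges.
Context {n : nat} (ell : 'rV[int]_n -> nat) (gam : 'rV[int]_n -> nat -> 'rV[int]_n).
Implicit Types (X Y : based_image n) (f : nat -> 'rV[int]_n) (x y z : 'rV[int]_n).

(** The path to the basepoint is required to be trivial; otherwise the product of
    the edges of a loop would be a conjugate of its class. *)
Definition path_system X := ell (basepoint X) = 0 /\
  forall x, x \in Defs.image X -> is_path X (ell x) (gam x) /\ gam x (ell x) = x.

Definition edge_fun x y := join (ell x) (gam x) (ell y) (gam y).
Definition edge X x y : pi1 X :=
  fclass X (ell x + (ell y).+1) (edge_fun x y).

Lemma edge_loop X x y : path_system X -> x \in Defs.image X -> y \in Defs.image X ->
  adj x y -> is_loop X (ell x + (ell y).+1) (edge_fun x y).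
Proof.
move=> [_ gP] xX yX xy; have [[px ex] [py ey]] := (gP x xX, gP y yX).
by apply: join_loop; rewrite ?ex ?ey.
Qed.

Lemma edge_cocycle X x y z : path_system X ->
    x \in Defs.image X -> y \in Defs.image X -> z \in Defs.image X ->
    adj x y -> adj y z -> adj x z ->
  (edge X x y * edge X y z)%g = edge X x z.
Proof.
move=> [_ gP] xX yX zX xy yz xz.
have [[px ex] [py ey]] := (gP x xX, gP y yX); have [pz ez] := gP z zX.
by rewrite /edge (join_mul px py pz) ?ex ?ey ?ez.
Qed.

(** Adding an edge to [f] multiplies the class by [edge (f N) (f N.+1)], whose
    first half cancels the return path from [f N]. *)
Lemma prod_edge X N f : path_system X -> is_path X N f ->
  (\prod_(i < N) edge X (f i) (f i.+1))%g =
    fclass X (N + (ell (f N)).+1) (join N f (ell (f N)) (gam (f N))).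
Proof.
move=> gS; have [e0 gP] := gS; elim: N => [|N IH] fP.
  have [f0 fX _] := fP; rewrite big_ord0 f0 e0 -(loop_class1 X 1).
  apply: loop_class_fclass => i _; rewrite lval_const /join.
  case: leqP => i0; first by rewrite (_ : i = 0) //; lia.
  have [[g0 _ _] _] := gP _ (basepoint_in X).
  by rewrite (_ : 0 + 1 - i = 0) ?g0 //; lia.
have fP' := is_path_take fP (leqnSn N).
have [_ fX fA] := fP.
have [pN eN] := gP _ (fX N (leqnSn N)).
have [pS eS] := gP _ (fX N.+1 (leqnn _)).
rewrite big_ord_recr /= (IH fP') join_last // join_mul // ?eN ?eS ?adj_refl //; exact: fA.
Qed.

Lemma prod_edge_loop X N f : path_system X -> is_loop X N f ->
  (\prod_(i < N) edge X (f i) (f i.+1))%g = fclass X N f.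
Proof.
move=> gS [fP fN]; rewrite (prod_edge gS fP) fN gS.1.
apply: (@fclass_reparam _ _ N _ _ _ (minn^~ N)) => //.
- by move=> i j *; lia.
- by move=> i _; apply: geq_minr.
- by rewrite min0n.
- by apply/minn_idPr; rewrite leq_addr.
- move=> i iN; rewrite /join; case: leqP => iN' //.
  have [[g0 _ _] _] := gS.2 _ (basepoint_in X).
  by rewrite fN (_ : N + 1 - i = 0) ?g0 //; lia.
Qed.

End Edges.

(** * Homomorphisms from cocycles *)

Section Walk.
Context {T : Type} {G : groupType} (w : T -> T -> G).
Implicit Types f g : nat -> T.

Definition walk f N : G := (\prod_(i < N) w (f i) (f i.+1))%g.

Lemma walk0 f : walk f 0 = 1%g. Proof. exact: big_ord0. Qed.

Lemma walkS f N : walk f N.+1 = (walk f N * w (f N) (f N.+1))%g.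
Proof. exact: big_ord_recr. Qed.

Lemma eq_walk f g N : (forall i, i <= N -> f i = g i) -> walk f N = walk g N.
Proof. by move=> fg; apply: eq_bigr => i _; rewrite !fg //; apply: ltnW. Qed.

Lemma walkSl f N : walk f N.+1 = (w (f 0) (f 1%N) * walk (fun i => f i.+1) N)%g.
Proof. exact: big_ord_recl. Qed.

Lemma walk_cat f M N : walk f (M + N) = (walk f M * walk (fun i => f (M + i)) N)%g.
Proof.
by rewrite /walk big_split_ord; congr (_ * _)%g; apply: eq_bigr => i _ /=; rewrite addnS.
Qed.

(** The two ways around each square of the ladder agree, so the top and bottom
    sides agree up to the two ends. *)
Lemma walk_ladder f g N :
    (forall i, i < N -> (w (f i) (f i.+1) * w (f i.+1) (g i.+1) =
                         w (f i) (g i) * w (g i) (g i.+1))%g) ->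
  (walk f N * w (f N) (g N) = w (f 0) (g 0) * walk g N)%g.
Proof.
elim: N => [|N IH] fg; first by rewrite !walk0 mul1g mulg1.
rewrite !walkS -mulgA fg // mulgA IH ?mulgA // => i iN; apply: fg; exact: leqW.
Qed.

Lemma walk_reparam f (s : nat -> nat) L : s 0 = 0 ->
    (forall i, i < L -> s i.+1 = s i \/ s i.+1 = (s i).+1) ->
    (forall i, i <= L -> w (f (s i)) (f (s i)) = 1%g) ->
  walk (f \o s) L = walk f (s L).
Proof.
move=> s0; elim: L => [|L IH] sS w1; first by rewrite s0 !walk0.
have IH' : walk (f \o s) L = walk f (s L).
  by apply: IH => i iL; [apply: sS | apply: w1]; lia.
rewrite walkS IH'.
have /= [->|->] := sS L (ltnSn L); last by rewrite walkS.
by rewrite w1 ?mulg1.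
Qed.

End Walk.

(** Cancellation in groups makes a map that preserves products preserve [1]. *)
Lemma multiplicative1 (A B : groupType) (h : {multiplicative A -> B}) : h 1%g = 1%g.
Proof. by apply: (@mulgI _ (h 1%g)); rewrite -gmulfM !mulg1. Qed.

Lemma multiplicative_prod (A B : groupType) (h : {multiplicative A -> B})
    N (u : 'I_N -> A) :
  h (\prod_(i < N) u i)%g = (\prod_(i < N) h (u i))%g.
Proof.
elim: N u => [|N IH] u; first by rewrite !big_ord0 multiplicative1.
by rewrite !big_ord_recr gmulfM IH.
Qed.

Section Cocycle.
Context {n : nat} (X : based_image n) (G : groupType) (w : 'rV[int]_n -> 'rV[int]_n -> G).
Hypothesis wM : forall x y z, x \in Defs.image X -> y \in Defs.image X ->
  z \in Defs.image X -> adj x y -> adj y z -> adj x z -> (w x y * w y z = w x z)%g.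

Lemma cocycle_diag x : x \in Defs.image X -> w x x = 1%g.
Proof.
by move=> xX; apply: (@mulgI _ (w x x)); rewrite wM ?adj_refl // mulg1.
Qed.

Definition loop_walk N (a : loop X N) : G := walk w (fun i => val (lval a i)) N.

(** Consecutive rows of a homotopy form a ladder whose squares are cliques: both
    ways around a square have value [w] on its diagonal. *)
Lemma walk_nhomotopic N (f g : nat -> Defs.image X) : nhomotopic N f g ->
  walk w (val \o f) N = walk w (val \o g) N.
Proof.
move=> [R [h [hc h0 h1 hb]]].
transitivity (walk w (fun i => val (h i R)) N); last first.
  by apply: eq_walk => i iN; rewrite h1.
transitivity (walk w (fun i => val (h i 0)) N).
  by apply: eq_walk => i iN; rewrite /= h0.
elim: R {h1} => // R ->.
pose u t i := val (h i t).
have uX t i : u t i \in Defs.image X by apply: valP.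
have := @walk_ladder _ _ w (u R) (u R.+1) N.
have -> : w (u R 0) (u R.+1 0) = 1%g.
  by rewrite /u (hb R).1 (hb R.+1).1 cocycle_diag //; apply: valP.
have -> : w (u R N) (u R.+1 N) = 1%g.
  by rewrite /u (hb R).2 (hb R.+1).2 cocycle_diag //; apply: valP.
rewrite mul1g mulg1; apply=> i iN.
by rewrite !wM //; apply: hc; lia.
Qed.

Lemma walk_subdivide k L N (a : loop X N) : L.+1 = k * N.+1 ->
  walk w (fun i => val (lval a (i %/ k))) L = loop_walk a.
Proof.
move=> e; transitivity (walk w ((fun i => val (lval a i)) \o (divn^~ k)) L) => //.
rewrite /loop_walk; move: (fun i => val (lval a i)) (loop_path a).
move=> f [[_ fX _] _]; rewrite -[in RHS](subdivide_last e).
apply: walk_reparam.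
- exact: div0n.
- move=> i iL; have := @divn_near k i.+1 i (leqnn _).
  have : i %/ k <= i.+1 %/ k by apply: leq_div2r.
  by move: (_ %/ _) (_ %/ _) => p q; lia.
- by move=> i iL; rewrite cocycle_diag // fX // (subdivide_bound e).
Qed.

Lemma loop_walk_homotopic M N (a : loop X M) (b : loop X N) :
  subdivision_homotopic a b -> loop_walk a = loop_walk b.
Proof.
move=> /subdivision_homotopicP[k [l [L [ek el /walk_nhomotopic]]]].
by rewrite -(walk_subdivide a ek) -(walk_subdivide b el).
Qed.

(** The extra step of [concat] between the two loops stays at the basepoint and
    contributes [1]. *)
Lemma loop_walk_concat M N (a : loop X M) (b : loop X N) :
  loop_walk (concat a b) = (loop_walk a * loop_walk b)%g.
Proof.
rewrite /loop_walk walk_cat; congr (_ * _)%g.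
  by apply: eq_walk => i iM; rewrite lval_concat ?iM //; lia.
rewrite walkSl addn0 addn1 !lval_concat; try lia.
rewrite leqnn ltnn subnn lvalN lval0 (cocycle_diag (basepoint_in X)) mul1g.
apply: eq_walk => i iN; rewrite lval_concat; last by lia.
have -> : (M + i.+1 <= M) = false by lia.
by congr (val (lval b _)); lia.
Qed.

Definition cocycle_map (c : pi1 X) : G := loop_walk (tagged (repr c)).

Lemma cocycle_mapE N (a : loop X N) : cocycle_map (loop_class a) = loop_walk a.
Proof. exact/loop_walk_homotopic/repr_class. Qed.

Lemma cocycle_map_morph : {morph cocycle_map : c d / (c * d)%g}.
Proof.
apply: loop_class_ind => M a; apply: loop_class_ind => N b.
by rewrite loop_classM !cocycle_mapE loop_walk_concat.
Qed.

Lemma cocycle_hom : exists phi : {multiplicative pi1 X -> G},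
  forall N f, is_loop X N f -> phi (fclass X N f) = walk w f N.
Proof.
pose m := isMultiplicative.Build (pi1 X) G cocycle_map cocycle_map_morph.
pose phi : {multiplicative pi1 X -> G} := HB.pack cocycle_map m.
exists phi => N f fL; rewrite [LHS]cocycle_mapE.
by apply: eq_walk => i iN; rewrite loop_ofE.
Qed.

End Cocycle.

Lemma fclass_ind n (X : based_image n) (P : pi1 X -> Prop) :
  (forall N f, is_loop X N f -> P (fclass X N f)) -> forall c, P c.
Proof.
move=> H; apply: loop_class_ind => N a.
by rewrite (@loop_class_fclass _ _ _ a (fun i => val (lval a i))) //; apply/H/loop_path.
Qed.

(** * Inclusions *)

Section Inclusions.
Context {n : nat} (X Y : {fset 'rV[int]_n}) (sXY : X `<=` Y) (x0 : 'rV[int]_n).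
Context (x0X : x0 \in X) (x0Y : x0 \in Y).
Local Notation bX := (BasedImage x0X).
Local Notation bY := (BasedImage x0Y).

Lemma is_path_sub N f : is_path bX N f -> is_path bY N f.
Proof.
by move=> [f0 fX fA]; split=> // i iN; apply: (fsubsetP sXY); apply: fX.
Qed.

Lemma is_loop_sub N f : is_loop bX N f -> is_loop bY N f.
Proof. by move=> [/is_path_sub]. Qed.

Lemma pi1_map_fclass N f : is_loop bX N f ->
  pi1_map (inclusion sXY x0X x0Y) (fclass bX N f) = fclass bY N f.
Proof.
move=> fL; rewrite pi1_mapE; apply: loop_class_fclass => i iN.
by rewrite -(loop_ofE fL iN).
Qed.

Lemma pi1_map_edge ell gam x y : path_system ell gam bX ->
    x \in X -> y \in X -> adj x y ->
  pi1_map (inclusion sXY x0X x0Y) (edge ell gam bX x y) = edge ell gam bY x y.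
Proof. by move=> gS xX yX xy; apply/pi1_map_fclass/edge_loop. Qed.

End Inclusions.

Lemma dconnected_path n (X : based_image n) x : dconnected X ->
  x \in Defs.image X -> exists N f, is_path X N f /\ f N = x.
Proof.
move=> cX xX; have [N [a [ac a0 aN]]] := cX [` xX].
exists N, (fun i => val (a (inord i))); split; last by rewrite inord_max aN.
split=> [|i _|i iN]; [by rewrite inord_0 a0 | exact: valP |].
by apply: ac; rewrite adj_ordE !inordK; lia.
Qed.

(** * The pushout square *)

Section VanKampen.
Context {n : nat} {U V : {fset 'rV[int]_n}} {x0 : 'rV[int]_n}.
Context (x0I : x0 \in U `&` V) (x0U : x0 \in U) (x0V : x0 \in V) (x0W : x0 \in U `|` V).
Local Notation bI := (BasedImage x0I).
Local Notation bU := (BasedImage x0U).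
Local Notation bV := (BasedImage x0V).
Local Notation bW := (BasedImage x0W).

(** Each point is joined to the basepoint inside the smallest of [U `&` V], [U],
    [V] that contains it, so a single choice serves all four images and the
    classes of edges are compatible with the inclusions. *)
Lemma adapted_path_system : dconnected bU -> dconnected bV -> dconnected bI ->
  exists ell gam, [/\ path_system ell gam bI, path_system ell gam bU,
                      path_system ell gam bV & path_system ell gam bW].
Proof.
move=> cU cV cI.
pose good (X : based_image n) (x : 'rV[int]_n) (p : nat * (nat -> 'rV[int]_n)) :=
  x \in Defs.image X -> is_path X p.1 p.2 /\ p.2 p.1 = x.
have subI Y (sIY : U `&` V `<=` Y) (x0Y : x0 \in Y) x p : x \in U `&` V ->
    good bI x p -> good (BasedImage x0Y) x p.
  by move=> xI /(_ xI)[pP pe] _; split=> //; apply: is_path_sub pP.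
have /choice[p pP] x : exists p, (x = x0 -> p.1 = 0) /\
    [/\ good bI x p, good bU x p & good bV x p].
  have [->|x_x0] := eqVneq x x0.
    by exists (0, fun=> x0); split=> //; split=> _; split=> //; split=> //.
  have xx0 (T : Prop) : x = x0 -> T by move=> e; rewrite e eqxx in x_x0.
  have [xI|xI] := boolP (x \in U `&` V).
    have [N [f fP]] := dconnected_path cI xI.
    exists (N, f); split; first exact: xx0.
    have gI : good bI x (N, f) by [].
    by split=> //; apply: subI gI; rewrite ?fsubsetIl ?fsubsetIr.
  have [xU|xU] := boolP (x \in U).
    have [N [f fP]] := dconnected_path cU xU.
    exists (N, f); split; first exact: xx0.
    split=> //= xX; first by rewrite xX in xI.
    by rewrite in_fsetI xU xX in xI.
  have [xV|xV] := boolP (x \in V).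
    have [N [f fP]] := dconnected_path cV xV.
    exists (N, f); split; first exact: xx0.
    split=> //= xX; first by rewrite xX in xI.
    by rewrite xX in xU.
  exists (0, fun=> x0); split=> //; split=> //= xX.
  - by rewrite xX in xI.
  - by rewrite xX in xU.
  - by rewrite xX in xV.
exists (fun x => (p x).1), (fun x => (p x).2).
have p0 : (p x0).1 = 0 by apply: (pP x0).1.
split; split=> //= x xX; have [_ [gI gU gV]] := pP x; try by auto.
move: xX; rewrite in_fsetU => /orP[/gU|/gV] [pX ->].
  by split=> //; apply: is_path_sub pX; apply: fsubsetUl.
by split=> //; apply: is_path_sub pX; apply: fsubsetUr.
Qed.

(** A clique contained in neither [U] nor [V] has a point outside [U] and a point
    outside [V]; these are adjacent and lie in the two complements. *)
Lemma clique_cover (P : 'rV[int]_n -> Prop) : disconnected_complements U V ->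
    (forall x, P x -> x \in U `|` V) ->
    (forall x y, P x -> P y -> adj x y) ->
  (forall x, P x -> x \in U) \/ (forall x, P x -> x \in V).
Proof.
move=> dc PW PA; apply: contrapT => /not_orP[/existsNP[v /not_implyP[Pv /negP vU]]].
move=> /existsNP[u /not_implyP[Pu /negP uV]].
have := PW _ Pv; have := PW _ Pu; rewrite !in_fsetU (negbTE vU) (negbTE uV) orbF /=.
move=> uU vV; apply: dc; exists u, v; split; last exact: PA.
  by rewrite in_fsetD in_fsetI uU (negbTE uV).
by rewrite in_fsetD in_fsetI vV (negbTE vU).
Qed.

(** The basepoint memberships are arbitrary here, so that no proof term has to be
    recognised inside the based images. *)
Lemma pushout_of_cover : dconnected bU -> dconnected bV -> dconnected bI ->
    disconnected_complements U V ->
  is_pushout (pi1_map (inclusion (fsubsetIl U V) x0I x0U))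
             (pi1_map (inclusion (fsubsetIr U V) x0I x0V))
             (pi1_map (inclusion (fsubsetUl U V) x0U x0W))
             (pi1_map (inclusion (fsubsetUr U V) x0V x0W)).
Proof.
move=> cU cV cI dc; split.
  apply: fclass_ind => N f fL /=.
  by rewrite !pi1_map_fclass //; apply: is_loop_sub fL; rewrite ?fsubsetIl ?fsubsetIr.
move=> G h1 h2 h12.
have [ell [gam [gI gU gV gW]]] := adapted_path_system cU cV cI.
(* Edges of [U `&` V] fall under the first case; [wV] shows that the second
   formula holds for them as well. *)
pose w x y := if (x \in U) && (y \in U) then h1 (edge ell gam bU x y)
              else h2 (edge ell gam bV x y).
have wU x y : x \in U -> y \in U -> w x y = h1 (edge ell gam bU x y).
  by move=> xU yU; rewrite /w xU yU.
have wV x y : x \in V -> y \in V -> adj x y -> w x y = h2 (edge ell gam bV x y).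
  move=> xV yV xy; rewrite /w; case: ifP => // /andP[xU yU].
  have xI : x \in U `&` V by rewrite in_fsetI xU.
  have yI : y \in U `&` V by rewrite in_fsetI yU.
  have := h12 (edge ell gam bI x y).
  by rewrite /= !pi1_map_edge.
have cover2 x y : x \in U `|` V -> y \in U `|` V -> adj x y ->
    (x \in U /\ y \in U) \/ (x \in V /\ y \in V).
  move=> xW yW xy; have [|a b|cl|cl] := @clique_cover (fun z => z = x \/ z = y) dc.
  - by move=> z [->|->].
  - by move=> [->|->] [->|->] //; rewrite ?adj_refl // adj_sym.
  - by left; split; apply: cl; auto.
  - by right; split; apply: cl; auto.
have wM x y z : x \in U `|` V -> y \in U `|` V -> z \in U `|` V ->
    adj x y -> adj y z -> adj x z -> (w x y * w y z = w x z)%g.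
  move=> xW yW zW xy yz xz.
  have [|a b|cl|cl] := @clique_cover (fun t => [\/ t = x, t = y | t = z]) dc.
  - by move=> t [->|->|->].
  - by move=> [->|->|->] [->|->|->] //; rewrite ?adj_refl // adj_sym.
  - have [xU yU] : x \in U /\ y \in U by split; apply: cl; [exact: Or31 | exact: Or32].
    have zU : z \in U by apply: cl; apply: Or33.
    by rewrite !wU // -gmulfM edge_cocycle.
  - have [xV yV] : x \in V /\ y \in V by split; apply: cl; [exact: Or31 | exact: Or32].
    have zV : z \in V by apply: cl; apply: Or33.
    by rewrite !wV // -gmulfM edge_cocycle.
have [phi phiE] := @cocycle_hom _ bW G w wM.
have loopU N f : is_loop bU N f -> is_loop bW N f by apply/is_loop_sub/fsubsetUl.
have loopV N f : is_loop bV N f -> is_loop bW N f by apply/is_loop_sub/fsubsetUr.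
exists phi; split.
- apply: fclass_ind => N f fL; have [[f0 fX fA] _] := fL.
  rewrite /= pi1_map_fclass // phiE; last exact: loopU.
  rewrite -(prod_edge_loop gU fL) multiplicative_prod; apply: eq_bigr => i _.
  by rewrite wU ?fX // ltnW.
- apply: fclass_ind => N f fL; have [[f0 fX fA] _] := fL.
  rewrite /= pi1_map_fclass // phiE; last exact: loopV.
  rewrite -(prod_edge_loop gV fL) multiplicative_prod; apply: eq_bigr => i _.
  by rewrite wV ?fX ?fA // ltnW.
- move=> phi' e1 e2; apply: fclass_ind => N f fL; have [[f0 fX fA] _] := fL.
  rewrite phiE // -(prod_edge_loop gW fL) multiplicative_prod; apply: eq_bigr => i _.
  have fi : adj (f i) (f i.+1) by apply: fA.
  have [[xU yU]|[xV yV]] := cover2 (f i) (f i.+1) (fX _ (ltnW (ltn_ord i))) (fX _ (ltn_ord i)) fi.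
    by rewrite wU // -e1 /= pi1_map_edge.
  by rewrite wV // -e2 /= pi1_map_edge.
Qed.

End VanKampen.

Theorem theorem5p5 (n : nat) (U V : {fset 'rV[int]_n}) (x0 : 'rV[int]_n)
    (x0I : x0 \in U `&` V) :
  let x0U := fsubsetP (fsubsetIl U V) x0 x0I in
  let x0V := fsubsetP (fsubsetIr U V) x0 x0I in
  let x0UV := fsubsetP (fsubsetUl U V) x0 x0U in
  dconnected (BasedImage x0U) ->
  dconnected (BasedImage x0V) ->
  dconnected (BasedImage x0I) ->
  disconnected_complements U V ->
  is_pushout (pi1_map (inclusion (fsubsetIl U V) x0I x0U))
             (pi1_map (inclusion (fsubsetIr U V) x0I x0V))
             (pi1_map (inclusion (fsubsetUl U V) x0U x0UV))
             (pi1_map (inclusion (fsubsetUr U V) x0V x0UV)).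
Proof. by move=> x0U x0V x0UV; apply: pushout_of_cover. Qed.
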